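(* Let $\mathcal T\subseteq\mathbb N$ be a symmetric numerical semigroup with $2\notin\mathcal T$, and write $\mathcal T\cap\{0,1,\dots,F(\mathcal T)-1\}=\{0,a_1,\dots,a_n\}$ with $0<a_1<\dots<a_n$. Then the projective monomial curve defined by $a_1<\dots<a_n$ (with $d=a_n$) is arithmetically Gorenstein.
   Context: Let $k$ be an infinite field. A numerical semigroup is a submonoid $\mathcal T\subseteq\mathbb N$ with finite complement; its Frobenius number is $F(\mathcal T)=\max(\mathbb N\setminus\mathcal T)$; $\mathcal T$ is symmetric if for every $b\in\mathbb N$, $b\in\mathcal T$ or $F(\mathcal T)-b\in\mathcal T$. For integers $0<a_1<\dots<a_n=d$ with $\gcd(a_1,\dots,a_n)=1$, the projective monomial curve they define is the curve $\mathcal C\subset\mathbb P^n_k$ with coordinate ring $k[\mathcal C]=k[x_0,\dots,x_n]/I$, $I$ the kernel of the $k$-algebra map $x_0\mapsto v^d$, $x_i\mapsto u^{a_i}v^{d-a_i}$; it is arithmetically Gorenstein if $k[\mathcal C]$ is Gorenstein (Cohen–Macaulay of type 1). *)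

(* Defs.v *)
From mathcomp Require Import all_boot all_order all_algebra.
From mathcomp Require Import mpoly.
Set Implicit Arguments. Unset Strict Implicit. Unset Printing Implicit Defensive.
Import GRing.Theory.
Local Open Scope ring_scope.

Definition numerical_semigroup (T : pred nat) : Prop :=
  [/\ T 0%N, (forall x y, T x -> T y -> T (x + y)%N)
    & exists N : nat, forall m, (N <= m)%N -> T m].

Definition is_frobenius (T : pred nat) (F : nat) : Prop :=
  ~~ T F /\ (forall m, (F < m)%N -> T m).

(* Symmetry: for every b ∈ ℕ, b ∈ T or F - b ∈ T (F - b taken in ℤ, so it is
   only possibly in T when b <= F). *)
Definition symmetric_sg (T : pred nat) (F : nat) : Prop :=
  forall b : nat, T b \/ ((b <= F)%N /\ T (F - b)%N).

Definition small_elts (T : pred nat) (F : nat) : seq nat :=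
  [seq i <- iota 1 F.-1 | T i].

Definition infinite_field (k : fieldType) : Prop :=
  forall s : seq k, exists x : k, x \notin s.

Section IdealTheory.
Variables (k : fieldType) (m : nat).
Local Notation P := {mpoly k[m]}.

Definition is_ideal (J : P -> Prop) : Prop :=
  [/\ J 0, (forall x y, J x -> J y -> J (x + y))
    & (forall r x, J x -> J (r * x))].

Definition gen_ideal (S : P -> Prop) : P -> Prop :=
  fun p => forall J, is_ideal J -> (forall x, S x -> J x) -> J p.

Definition is_prime_ideal (J : P -> Prop) : Prop :=
  [/\ is_ideal J, ~ J 1 & (forall x y, J (x * y) -> J x \/ J y)].

Definition subset_ideal (J1 J2 : P -> Prop) : Prop := forall x, J1 x -> J2 x.

(* A strictly increasing chain of primes J 0 ⊊ ... ⊊ J r, all containing I,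
   i.e. a chain of primes of length r in P/I. *)
Definition prime_chain_over (I : P -> Prop) (r : nat) (J : nat -> P -> Prop) : Prop :=
  (forall i, (i <= r)%N -> is_prime_ideal (J i) /\ subset_ideal I (J i)) /\
  (forall i, (i < r)%N -> subset_ideal (J i) (J i.+1) /\ exists x, J i.+1 x /\ ~ J i x).

Definition krull_dim_quot (I : P -> Prop) (r : nat) : Prop :=
  (exists J, prime_chain_over I r J) /\ ~ (exists J, prime_chain_over I r.+1 J).

Definition ideal_plus (I : P -> Prop) (s : seq P) : P -> Prop :=
  gen_ideal (fun x => I x \/ x \in s).

(* The homogeneous maximal ideal of P/I, as the ideal I + (x_0,...,x_{m-1}) of P. *)
Definition irrelevant_over (I : P -> Prop) : P -> Prop :=
  gen_ideal (fun x => I x \/ exists i : 'I_m, x = 'X_i).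

Definition regular_seq_in_max (I : P -> Prop) (f : seq P) : Prop :=
  [/\ (forall x, x \in f -> irrelevant_over I x),
      (forall i, (i < size f)%N -> forall g,
          ideal_plus I (take i f) (g * nth 0 f i) -> ideal_plus I (take i f) g)
    & ~ ideal_plus I f 1].

Definition depth_quot (I : P -> Prop) (r : nat) : Prop :=
  (exists f, size f = r /\ regular_seq_in_max I f) /\
  ~ (exists f, size f = r.+1 /\ regular_seq_in_max I f).

Definition cohen_macaulay_quot (I : P -> Prop) : Prop :=
  exists r, krull_dim_quot I r /\ depth_quot I r.

(* Type 1: for a maximal regular sequence f, the socle of P/(I + (f)),
   i.e. {x | m x ⊆ I + (f)} modulo I + (f), is a 1-dimensional k-space. *)
Definition socle_dim_one (I : P -> Prop) (f : seq P) : Prop :=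
  let J := ideal_plus I f in
  let soc := fun x => forall y, irrelevant_over I y -> J (y * x) in
  exists x, [/\ soc x, ~ J x &
    forall y, soc y -> exists c : k, J (y - c *: x)].

Definition gorenstein_quot (I : P -> Prop) : Prop :=
  cohen_macaulay_quot I /\
  exists r f, [/\ depth_quot I r, size f = r, regular_seq_in_max I f
                & socle_dim_one I f].

End IdealTheory.

(* For a = [:: a_1; ...; a_n] (with d = a_n), the images of x_0,...,x_n
   in k[u,v] = {mpoly k[2]} with u = 'X_0, v = 'X_1:
   x_0 |-> v^d,  x_i |-> u^{a_i} v^{d - a_i}. *)
Definition monomial_images (k : fieldType) (a : seq nat) :
    (size a).+1.-tuple {mpoly k[2]} :=
  let d := last 0%N a in
  [tuple (if (i : nat) == 0%N then 'X_1 ^+ d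
          else 'X_0 ^+ (nth 0%N a i.-1) * 'X_1 ^+ (d - nth 0%N a i.-1))
   | i < (size a).+1].

Definition monomial_curve_ideal (k : fieldType) (a : seq nat) :
    {mpoly k[(size a).+1]} -> Prop :=
  fun p => p \mPo @monomial_images k a = 0.

Definition arith_gorenstein_curve (k : fieldType) (a : seq nat) : Prop :=
  gorenstein_quot (@monomial_curve_ideal k a).

(* Main.v *)
Require Import Defs.
From mathcomp Require Import all_boot all_order all_algebra.
From mathcomp Require Import mpoly.
From mathcomp Require Import zify.
Set Implicit Arguments. Unset Strict Implicit. Unset Printing Implicit Defensive.

(** Put d = F - 1. The point is that the affine semigroup S of the curve consists
    of all (x, y) with x in T and d | x + y: nothing is lost by taking sums of
    elements of T below F. From this description x_0 = v^d, x_n = u^d is a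
    regular sequence, and the monomials surviving modulo both parameters are
    indexed by the Apery set of T with respect to d. Symmetry of T makes this set
    invariant under m |-> w - m, where w = (2d + 1, d - 1), so the socle is
    spanned by the monomial w.

    Both upper bounds dim <= 2 and depth <= 2 come from one observation: a chain
    of primes or a regular sequence of length 3 would give three elements of
    k[u, v] that are algebraically independent over k. *)

(** * Symmetric numerical semigroups *)

Section SymmetricSemigroup.
Variables (T : pred nat) (F : nat).
Hypotheses (sgT : numerical_semigroup T) (frobT : is_frobenius T F).
Hypotheses (symT : symmetric_sg T F) (T2 : ~~ T 2).

Lemma semigroup0 : T 0. Proof. by case: sgT. Qed.

Lemma semigroupD x y : T x -> T y -> T (x + y).
Proof. by case: sgT => _ + _; apply. Qed.

Lemma semigroupMn x j : T x -> T (j * x).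
Proof.
by move=> Tx; elim: j => [|j IHj]; rewrite ?mulSn ?semigroup0 ?semigroupD.
Qed.

Lemma notin_frobenius : ~~ T F. Proof. by case: frobT. Qed.

Lemma gt_frobenius x : F < x -> T x. Proof. by case: frobT => _; apply. Qed.

(** If [x] and [F - x] were both in [T], so would be their sum [F]; the converse is the symmetry
    hypothesis. *)
Lemma symmetricP x : x <= F -> T (F - x) = ~~ T x.
Proof.
move=> xF; apply/idP/idP => [TFx|nTx].
  apply/negP => Tx; move: notin_frobenius.
  by rewrite -(subnK xF) semigroupD.
by case: (symT x) => [Tx|[]//]; rewrite Tx in nTx.
Qed.

Lemma semigroup_ge3 x : T x -> 0 < x -> 2 < x.
Proof.
have F0 : F != 0 by apply: contraNneq notin_frobenius => ->; exact: semigroup0.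
have T1 : ~~ T 1 by apply: contra T2 => T1; exact: (semigroupD T1 T1).
by case: x => [|[|[|]]] // Tx _; [move: T1 | move: T2]; rewrite Tx.
Qed.

(** Since 1 and 2 are gaps, symmetry puts [F - 1] and [F - 2] in [T]. The first forces [F >= 4], and
    [F = 4] would make the second equal to 2. *)
Lemma frobenius_ge5 : 4 < F.
Proof.
have TN x : T x -> 0 < x -> 2 < x := @semigroup_ge3 x.
have nT1 : ~~ T 1 by apply/negP => /TN; lia.
have F2 : 2 <= F by rewrite leqNgt; apply: contra T2; exact: gt_frobenius.
have TF1 : T (F - 1) by rewrite symmetricP //; lia.
have TF2 : T (F - 2) by rewrite symmetricP //; lia.
have := TN _ TF1 ltac:(lia).
case: (F =P 4) => [F4|]; last by lia.
by move: TF2 T2; rewrite F4 => ->.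
Qed.

Let d := F.-1.

Lemma semigroup_pred_frobenius : T F.-1.
Proof.
have F5 := frobenius_ge5; rewrite -subn1 symmetricP; last by lia.
by apply/negP => /semigroup_ge3; lia.
Qed.

Lemma semigroup_pred2_frobenius : T F.-2.
Proof.
have F5 := frobenius_ge5; rewrite -subn2 symmetricP //; lia.
Qed.

(* If no such decomposition exists, then, with h = g - 1, the set of positive
   elements of T up to d is stable under subtracting h wherever the result is
   positive; together with the stability under adding the multiplicity m this
   makes all of them multiples of m, contradicting d - 1, d \in T. *)
Lemma gap_shift_decomposition g :
  2 <= g -> g < F.-1 -> ~~ T g ->
  exists a, [/\ g <= a, a <= F.-1, T a & T (F.-1 + g - a)].
Proof.
move=> g2 gd nTg; have F5 := frobenius_ge5.
case: (boolP (has (fun a => T a && T (F.-1 + g - a)) (iota g (F - g)))).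
  by case/hasP=> a; rewrite mem_iota => ? /andP[Ta Ta']; exists a; split=> //; lia.
move=> /hasPn noa; exfalso.
pose h := g.-1.
(* The partner [F.-1 + g - a] equals [F - (a - h)], so by symmetry its absence from [T] means that
   [a - h] is present. *)
have subh a : T a -> h < a -> a <= d -> T (a - h).
  move=> Ta ha ad.
  have /noa : a \in iota g (F - g) by rewrite mem_iota; lia.
  rewrite Ta /= -symmetricP; last by lia.
  by congr (is_true (T _)); lia.
have exm : exists m, T m && (0 < m).
  by exists F.-1; rewrite semigroup_pred_frobenius; lia.
case: (ex_minnP exm) => m /andP[Tm m0] minm.
have dTd : T d by exact: semigroup_pred_frobenius.
have hm : h + m <= d.
  have := minm (d - h); rewrite subh //; lia.
(* [a + j * m] is the first term of a, a + m, ... beyond [h], hence at most [h + m <= d].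
   Subtracting [h] leaves a positive element of [T] of size at most [m], thus [m] itself. *)
have cong_h a : T a -> 0 < a -> a <= h -> h = a %[mod m].
  move=> Ta a0 ah; pose j := ((h - a) %/ m).+1.
  have := divn_eq (h - a) m; have := ltn_pmod (h - a) m0 => ltm eqm.
  have := minm (a + j * m - h).
  rewrite subh ?semigroupD ?semigroupMn //; try by rewrite /j mulSn; lia.
  move=> /(_ ltac:(rewrite /j mulSn; lia)) lem.
  have -> : h = a + (h - a) %/ m * m by move: lem; rewrite /j mulSn; lia.
  by rewrite addnC modnMDl.
have reduce a : T a -> 0 < a -> a <= d ->
    exists2 b, [/\ T b, 0 < b & b <= h] & exists q, a = b + q * h.
  elim/ltn_ind: a => a IHa Ta a0 ad.
  case: (leqP a h) => [ah|ha]; first by exists a; [split|exists 0; lia].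
  case: (IHa (a - h)); try lia; first by exact: subh.
  by move=> b ? [q eqa]; exists b => //; exists q.+1; rewrite mulSn; lia.
have mh : m <= h.
  case: (reduce d dTd) => [||b [Tb b0 bh] _]; try lia.
  have := minm b; rewrite Tb; lia.
have m_dvd_h : m %| h by rewrite /dvdn (cong_h m) ?modnn.
have dvdm a : T a -> 0 < a -> a <= d -> m %| a.
  move=> Ta a0 ad; case: (reduce a Ta a0 ad) => b [Tb b0 bh] [q ->].
  by rewrite dvdn_addl ?dvdn_mull // /dvdn -(cong_h b).
have := dvdm d dTd; have := dvdm F.-2 semigroup_pred2_frobenius.
move=> /(_ ltac:(lia) ltac:(lia)) d2 /(_ ltac:(lia) ltac:(lia)) d1.
have : m %| 1 by rewrite (_ : 1 = F.-1 - F.-2) ?dvdn_sub //; lia.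
rewrite dvdn1 => /eqP m1.
by have := semigroup_ge3 Tm; rewrite m1; lia.
Qed.

(** Inductive step for writing an element of [T] up to N d as a sum of N elements of [T] in [0, d].
    If neither [x] nor [F.-1] can be split off, [x - F.-1] is a gap. It is not 1 because [x] is not
    [F]; for the gap [F] the summand [F.-2] leaves [F + 1]; the other gaps fall under
    [gap_shift_decomposition]. *)
Lemma semigroup_split_summand N x :
  T x -> x <= N.+1 * F.-1 ->
  exists a, [/\ T a, a <= F.-1, a <= x, T (x - a) & x - a <= N * F.-1].
Proof.
have F5 := frobenius_ge5; rewrite mulSn => Tx xN.
case: (leqP x F.-1) => [xd|dx].
  by exists x; split=> //; rewrite ?subnn ?semigroup0 //; lia.
case: (boolP (T (x - F.-1))) => [Txd|nTxd].
  exists F.-1; split=> //; rewrite ?semigroup_pred_frobenius //; lia.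
have xF : x - F.-1 <= F by rewrite leqNgt; apply: contra nTxd; exact: gt_frobenius.
have neqF : x != F by apply: contraTneq Tx => ->; exact: notin_frobenius.
have neqd : x - F.-1 != F.-1.
  by apply: contraNneq nTxd => ->; exact: semigroup_pred_frobenius.
case: (ltnP (x - F.-1) F) => [ltF|geF]; last first.
  have N2 : 2 <= N by case: N xN => [|[|N]] //; lia.
  exists F.-2; split=> //; try lia; first exact: semigroup_pred2_frobenius.
  - by apply: gt_frobenius; lia.
  - have : 2 * F.-1 <= N * F.-1 by rewrite leq_mul2r N2 orbT.
    lia.
have N1 : 1 <= N by case: N xN => //; lia.
have [||a [ga ad Ta Ta']] := gap_shift_decomposition _ _ nTxd; try lia.
have eqx : F.-1 + (x - F.-1) = x by lia.
rewrite eqx in Ta'; exists a; split=> //; try lia.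
have : F.-1 <= N * F.-1 by rewrite leq_pmull.
lia.
Qed.

End SymmetricSemigroup.

(** * Towers of ideals and algebraic independence *)

Section Ideals.
Import GRing.Theory.
Local Open Scope ring_scope.
Variables (k : fieldType) (n : nat).
Local Notation P := {mpoly k[n]}.
Implicit Types (I J K : P -> Prop) (S : P -> Prop) (p q : P).

Lemma idealN J p : is_ideal J -> J p -> J (- p).
Proof. by case=> _ _ JM Jp; rewrite -mulN1r; apply: JM. Qed.

Lemma idealDl J p q : is_ideal J -> J q -> J (p + q) -> J p.
Proof.
move=> idJ Jq Jpq; have [_ JD _] := idJ.
by rewrite -(addrK q p); apply: JD => //; apply: idealN.
Qed.

Lemma gen_ideal_is_ideal S : is_ideal (gen_ideal S).
Proof.
split=> [J [] //|p q Sp Sq J idJ SJ|r p Sp J idJ SJ]; have [_ JD JM] := idJ.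
- by apply: JD; [apply: Sp | apply: Sq].
- by apply: JM; apply: Sp.
Qed.

Lemma mem_gen_ideal S p : S p -> gen_ideal S p.
Proof. by move=> Sp J _; apply. Qed.

Lemma gen_ideal_sub S J :
  is_ideal J -> (forall p, S p -> J p) -> subset_ideal (gen_ideal S) J.
Proof. by move=> idJ SJ p; apply. Qed.

Lemma gen_idealS S1 S2 :
  (forall p, S1 p -> S2 p) -> subset_ideal (gen_ideal S1) (gen_ideal S2).
Proof. by move=> S12 p Sp J idJ S2J; apply: Sp => // x /S12/S2J. Qed.

Lemma eq_gen_ideal S1 S2 p :
  (forall p, S1 p <-> S2 p) -> gen_ideal S1 p <-> gen_ideal S2 p.
Proof. by move=> S12; split; apply: gen_idealS => q; rewrite S12. Qed.

Lemma ideal_plus_nil I p : is_ideal I -> ideal_plus I [::] p <-> I p.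
Proof.
move=> idI; split=> [|Ip]; first by apply: gen_ideal_sub => // q [].
by apply: mem_gen_ideal; left.
Qed.

(* The common pattern behind chains of prime ideals and regular sequences: both
   yield ideals K_0 <= K_1 <= ... and elements x_i in K_i that are
   nonzerodivisors modulo K_(i-1). *)
Definition nonzerodivisor_step K K' x : Prop :=
  [/\ subset_ideal K K', K' x & forall g, K (g * x) -> K g].

(** Modulo [K'] the element [x] vanishes, so the constant coefficient lies in [K'] and is zero. The
    rest is a multiple of [x], which cancels modulo [K] and leaves a shorter relation. *)
Lemma nonzerodivisor_step_independent K K' x N (g : nat -> P) :
  is_ideal K -> is_ideal K' -> nonzerodivisor_step K K' x ->
  (forall i, (i < N)%N -> K' (g i) -> g i = 0) ->
  K (\sum_(i < N) g i * x ^+ i) ->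
  forall i, (i < N)%N -> g i = 0.
Proof.
move=> idK idK' [KK' K'x xreg].
elim: N g => [|N IHN] g // g0 Kg.
have [_ _ K'M] := idK'.
move: Kg; rewrite big_ord_recl expr0 mulr1 => Kg.
have eqS : \sum_(i < N) g (lift ord0 i) * x ^+ lift ord0 i =
    (\sum_(i < N) g i.+1 * x ^+ i) * x.
  by rewrite mulr_suml; apply: eq_bigr => i _; rewrite lift0 exprSr mulrA.
have g00 : g 0%N = 0.
  apply: g0 => //; apply: idealDl (KK' _ Kg) => //.
  by rewrite eqS; apply: K'M.
move: Kg; rewrite g00 add0r eqS => /xreg Kg [|i] // iN.
by apply: (IHN (fun i => g i.+1)) => // j jN; apply: (g0 j.+1).
Qed.

(** Nested with [x1] outermost and [x3] innermost, so that each step of a tower peels off one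
    layer. *)
Definition trinomial_sum (x1 x2 x3 : P) N (c : nat -> nat -> nat -> k) : P :=
  \sum_(i < N) (\sum_(j < N) (\sum_(l < N) (c i j l)%:MP * x3 ^+ l) * x2 ^+ j) * x1 ^+ i.

(** A nonzero constant in [K 3] would put 1 there, so constants meet [K 3] only in 0. From this the
    layers are treated from the innermost outwards, one step of the tower for each. *)
Lemma nonzerodivisor_tower_independent (K : nat -> P -> Prop) (x : nat -> P) N c :
  (forall i, (i <= 3)%N -> is_ideal (K i)) -> ~ K 3%N 1 ->
  (forall i, (i < 3)%N -> nonzerodivisor_step (K i) (K i.+1) (x i)) ->
  K 0%N (trinomial_sum (x 0%N) (x 1%N) (x 2%N) N c) ->
  forall i j l, (i < N)%N -> (j < N)%N -> (l < N)%N -> c i j l = 0.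
Proof.
move=> idK K31 step.
have const a : K 3%N a%:MP -> a = 0.
  move=> Ka; case: (eqVneq a 0) => // a0; case: K31.
  by rewrite -(mpolyC1 n k) -(mulVf a0) mpolyCM; case: (idK 3%N) => // _ _; apply.
have zero i : (i <= 3)%N -> K i 0 by move=> /idK[].
have inner (c' : nat -> k) : K 2%N (\sum_(l < N) (c' l)%:MP * x 2%N ^+ l) ->
    forall l, (l < N)%N -> c' l = 0.
  move=> Kc l lN; apply/eqP; rewrite -(mpolyC_eq0 n); apply/eqP.
  apply: (nonzerodivisor_step_independent (g := fun l => (c' l)%:MP)
    (idK 2%N _) (idK 3%N _) (step 2%N _)) Kc _ lN => // {}l _ /const ->.
  exact: mpolyC0.
have middle (c' : nat -> nat -> k) :
    K 1%N (\sum_(j < N) (\sum_(l < N) (c' j l)%:MP * x 2%N ^+ l) * x 1%N ^+ j) ->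
    forall j l, (j < N)%N -> (l < N)%N -> c' j l = 0.
  move=> Kc j l jN lN; apply: (inner) lN.
  pose g j := \sum_(l < N) (c' j l)%:MP * x 2%N ^+ l.
  suff -> : \sum_(l < N) (c' j l)%:MP * x 2%N ^+ l = 0 by exact: zero.
  apply: (nonzerodivisor_step_independent (g := g)
    (idK 1%N _) (idK 2%N _) (step 1%N _) _ Kc) => // {jN}j _ /inner c0.
  by rewrite /g big1 // => i' _; rewrite c0 ?mpolyC0 ?mul0r.
move=> Kc i j l iN jN lN; apply: (middle) jN lN.
pose g i := \sum_(j < N) (\sum_(l < N) (c i j l)%:MP * x 2%N ^+ l) * x 1%N ^+ j.
suff -> : \sum_(j < N) (\sum_(l < N) (c i j l)%:MP * x 2%N ^+ l) * x 1%N ^+ j = 0.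
  exact: zero.
apply: (nonzerodivisor_step_independent (g := g)
  (idK 0%N _) (idK 1%N _) (step 0%N _) _ Kc) => // {iN}i _ /middle c0.
rewrite /g big1 // => j' _; rewrite big1 ?mul0r // => l' _.
by rewrite c0 ?mpolyC0 ?mul0r.
Qed.
End Ideals.

(** * Algebraic dependence of three polynomials in two variables *)

Section Dependence.
Import GRing.Theory.
Local Open Scope ring_scope.
Variables (k : fieldType).

Lemma msize_mul_leS n (p q : {mpoly k[n]}) a b :
  (msize p <= a.+1)%N -> (msize q <= b.+1)%N -> (msize (p * q) <= (a + b).+1)%N.
Proof.
have [-> _ _|p0] := eqVneq p 0; first by rewrite mul0r msize0.
have [-> _ _|q0] := eqVneq q 0; first by rewrite mulr0 msize0.
by rewrite msizeM //; move: (msize p) (msize q) => x y; lia.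
Qed.

Lemma msize_exp_le n (p : {mpoly k[n]}) D i :
  (msize p <= D.+1)%N -> (msize (p ^+ i) <= (D * i).+1)%N.
Proof.
move=> pD; elim: i => [|i IHi]; first by rewrite expr0 msize1.
by rewrite exprS mulnS; apply: msize_mul_leS.
Qed.

(** Counting: the N^3 products of powers lie in the span of M^2 monomials with M linear in N, so for
    large N they are linearly dependent. *)
Lemma three_bivariate_dependent (f : nat -> {mpoly k[2]}) :
  exists N (c : nat -> nat -> nat -> k),
    trinomial_sum (f 0%N) (f 1%N) (f 2%N) N c = 0 /\
    exists i j l, [/\ (i < N)%N, (j < N)%N, (l < N)%N & c i j l != 0].
Proof.
pose D := (msize (f 0%N) + msize (f 1%N) + msize (f 2%N))%N.
(* [D] bounds the three degrees, [M] exceeds the degree of every product, and M^2 <= (3D + 1)^2 N^2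
   < N^3. *)
pose N := ((3 * D + 1) ^ 2).+1; pose M := (3 * (D * N) + 1)%N.
pose I := ('I_N * 'I_N * 'I_N)%type; pose J := ('I_M * 'I_M)%type.
pose term (i j l : nat) := f 2%N ^+ l * f 1%N ^+ j * f 0%N ^+ i.
have szterm i j l : (i < N)%N -> (j < N)%N -> (l < N)%N -> (msize (term i j l) <= M)%N.
  move=> iN jN lN.
  have szf j' m : (j' < 3)%N -> (m < N)%N -> (msize (f j' ^+ m) <= (D * N).+1)%N.
    move=> j'3 mN; apply: leq_trans (msize_exp_le (D := D) _ _) _.
      by rewrite /D; case: j' j'3 => [|[|[|]]] // _; lia.
    by rewrite ltnS leq_mul2l ltnW ?orbT.
  apply: (@leq_trans (D * N + D * N + D * N).+1); last by rewrite /M; lia.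
  by rewrite !msize_mul_leS ?szf.
pose mon (b : J) : 'X_{1..2} := [multinom if (i : nat) == 0%N then b.1 : nat else b.2 | i < 2].
pose A : 'M[k]_(#|{: I}|, #|{: J}|) :=
  \matrix_(a, b) (let s : I := enum_val a in (term s.1.1 s.1.2 s.2)@_(mon (enum_val b))).
have kerA : kermx A != 0.
  rewrite kermx_eq0 /row_free neq_ltn; apply/orP; left.
  apply: leq_ltn_trans (rank_leq_col A) _.
  rewrite !card_prod !card_ord /M.
  have -> : (3 * (D * N) + 1 = (3 * D) * N + 1)%N by lia.
  have : ((3 * D) * N + 1 <= (3 * D + 1) * N)%N by rewrite /N; lia.
  move=> le; apply: leq_ltn_trans (leq_mul le le) _.
  have -> : ((3 * D + 1) * N * ((3 * D + 1) * N) = (3 * D + 1) ^ 2 * (N * N))%N by lia.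
  by rewrite -mulnA [X in (_ < X)%N]mulnC mulnC ltn_pmul2l // /N; lia.
have /rowV0Pn[v /sub_kermxP vA v0] := kerA.
pose c (i j l : nat) : k :=
  if (insub i, insub j, insub l) is (Some i', Some j', Some l')
  then v 0 (enum_rank ((i', j', l') : I)) else 0.
have cE (a : I) : c a.1.1 a.1.2 a.2 = v 0 (enum_rank a).
  by case: a => [[i j] l]; rewrite /c /= !valK.
exists N, c; split; last first.
  have /rV0Pn[a va] := v0; pose b := enum_val a.
  exists b.1.1, b.1.2, b.2; split=> //.
  by rewrite cE enum_valK.
have -> : trinomial_sum (f 0%N) (f 1%N) (f 2%N) N c =
    \sum_(a : I) c a.1.1 a.1.2 a.2 *: term a.1.1 a.1.2 a.2.
  rewrite -(pair_big xpredT xpredT (fun (p : 'I_N * 'I_N) (l : 'I_N) =>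
    c p.1 p.2 l *: term p.1 p.2 l)) /=.
  rewrite -(pair_big xpredT xpredT (fun (i j : 'I_N) =>
    \sum_(l < N) c i j l *: term i j l)) /=.
  apply: eq_bigr => i _; rewrite mulr_suml; apply: eq_bigr => j _.
  rewrite !mulr_suml; apply: eq_bigr => l _.
  by rewrite -!mulrA mul_mpolyC /term !mulrA.
apply/mpolyP => m; rewrite mcoeff0 raddf_sum /=.
have [mM|Mm] := ltnP (mdeg m) M; last first.
  rewrite big1 // => a _; rewrite mcoeffZ memN_msupp_eq0 ?mulr0 //.
  by apply: msize_mdeg_ge; apply: leq_trans Mm; apply: szterm.
have mi i : (m i < M)%N.
  by apply: leq_ltn_trans mM; rewrite mdegE (bigD1 i) //= leq_addr.
pose b : J := (Ordinal (mi 0), Ordinal (mi 1)).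
have mE : mon b = m.
  apply/mnmP => i; rewrite mnmE /=.
  by case: i => [[|[|]]] // ?; congr (m _); apply: val_inj.
have := congr1 (fun w : 'rV_ _ => w 0 (enum_rank b)) vA.
rewrite !mxE => vA0; apply: etrans vA0.
rewrite (reindex (fun a : 'I_#|{: I}| => enum_val a : I)) /=; last first.
  by exists enum_rank => a _; rewrite ?enum_valK ?enum_rankK.
apply: eq_bigr => a _; by rewrite mcoeffZ cE enum_valK !mxE enum_rankK mE.
Qed.

End Dependence.

(** * Upper bounds for dimension and depth *)

Section Dimension.
Import GRing.Theory.
Local Open Scope ring_scope.
Variables (k : fieldType) (n : nat).
Local Notation P := {mpoly k[n]}.

Lemma rmorphism_kernel_prime (R : idomainType) (f : {rmorphism P -> R}) :
  is_prime_ideal (fun p => f p = 0).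
Proof.
split=> [||x y]; last 2 first.
- by rewrite rmorph1; apply/eqP; exact: oner_neq0.
- by rewrite rmorphM => /eqP; rewrite mulf_eq0 => /orP[]/eqP; [left | right].
split=> [|x y fx fy|r x fx]; first exact: rmorph0.
- by rewrite rmorphD fx fy addr0.
- by rewrite rmorphM fx mulr0.
Qed.

Variables (h : n.-tuple {mpoly k[2]}) (I : P -> Prop).
Hypothesis I_kernel : forall p, I p <-> p \mPo h = 0.

Lemma kernel_is_ideal : is_ideal I.
Proof.
have [[K0 KD KM] _ _] := rmorphism_kernel_prime (comp_mpoly h).
split=> [|x y|r x]; rewrite !I_kernel; [exact: K0 | exact: KD | exact: KM].
Qed.

(** A relation among the three images pulls back to a relation among the [x i] modulo [I], hence
    modulo [K 0], against the independence given by the tower. *)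
Lemma no_tower_over_bivariate_kernel (K : nat -> P -> Prop) (x : nat -> P) :
  subset_ideal I (K 0%N) -> (forall i, (i <= 3)%N -> is_ideal (K i)) -> ~ K 3%N 1 ->
  ~ (forall i, (i < 3)%N -> nonzerodivisor_step (K i) (K i.+1) (x i)).
Proof.
move=> IK idK K31 step.
have [N [c [sum0 [i [j [l [iN jN lN /eqP[]]]]]]]] :=
  three_bivariate_dependent (fun i => x i \mPo h).
apply: (nonzerodivisor_tower_independent idK K31 step) iN jN lN.
apply/IK/I_kernel; rewrite -sum0 /trinomial_sum.
rewrite raddf_sum /=; apply: eq_bigr => a _; rewrite rmorphM rmorphXn /=; congr (_ * _).
rewrite raddf_sum /=; apply: eq_bigr => b _; rewrite rmorphM rmorphXn /=; congr (_ * _).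
rewrite raddf_sum /=; apply: eq_bigr => d _; rewrite rmorphM rmorphXn /=; congr (_ * _).
exact: comp_mpolyC.
Qed.

(** Any element of [J i.+1] outside [J i] is a nonzerodivisor modulo the prime [J i], so a strict
    chain is a tower. *)
Lemma no_prime_chain3_over_bivariate_kernel : ~ exists J, prime_chain_over I 3 J.
Proof.
case=> J [primeJ strictJ].
have [_ [y0 [y0K y0n]]] := strictJ 0%N isT.
have [_ [y1 [y1K y1n]]] := strictJ 1%N isT.
have [_ [y2 [y2K y2n]]] := strictJ 2%N isT.
apply: (no_tower_over_bivariate_kernel (K := J) (x := nth 0 [:: y0; y1; y2])).
- by have [] := primeJ 0%N isT.
- by move=> i /primeJ[[]].
- by have [[]] := primeJ 3%N isT.
- move=> i i3; have [[idJ _ Jprime] _] := primeJ i (ltnW i3).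
  have [JJ _] := strictJ i i3; split=> // [|g].
    by case: i i3 {idJ Jprime JJ} => [|[|[|]]].
  by move=> /Jprime[] //; case: i i3 {idJ Jprime JJ} => [|[|[|]]].
Qed.

Lemma no_regular_seq3_over_bivariate_kernel :
  ~ exists f, size f = 3 /\ regular_seq_in_max I f.
Proof.
case=> f [sz_f [_ f_reg f_proper]].
apply: (no_tower_over_bivariate_kernel
          (K := fun i => ideal_plus I (take i f)) (x := nth 0 f)).
- by move=> p Ip; apply: mem_gen_ideal; left.
- by move=> i _; apply: gen_ideal_is_ideal.
- by rewrite take_oversize ?sz_f.
- move=> i i3; split.
  + apply: gen_idealS => p [Ip|pf]; [by left | right].
    by rewrite (take_nth 0) ?sz_f // mem_rcons inE pf orbT.
  + apply: mem_gen_ideal; right.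
    by rewrite (take_nth 0) ?sz_f // mem_rcons mem_head.
  + by apply: f_reg; rewrite sz_f.
Qed.

End Dimension.

(** * Monomial subalgebras *)

Section MonomialAlgebra.
Import GRing.Theory.
Local Open Scope ring_scope.
Variables (k : fieldType) (r : nat).
Implicit Types (E : 'X_{1..r} -> Prop) (g : {mpoly k[r]}).

Definition supported_in E g : Prop := forall m, m \in msupp g -> E m.

Lemma supported_in0 E : supported_in E 0.
Proof. by move=> m; rewrite msupp0. Qed.

Lemma supported_inD E g1 g2 :
  supported_in E g1 -> supported_in E g2 -> supported_in E (g1 + g2).
Proof. by move=> E1 E2 m /msuppD_le; rewrite mem_cat => /orP[/E1|/E2]. Qed.

Lemma supported_inZ E c g : supported_in E g -> supported_in E (c *: g).
Proof. by move=> Eg m /msuppZ_le/Eg. Qed.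

Lemma supported_inX E m : E m -> supported_in E 'X_[m].
Proof. by move=> Em m'; rewrite msuppX inE => /eqP->. Qed.

Lemma supported_inM E1 E2 E g1 g2 :
  (forall m1 m2, E1 m1 -> E2 m2 -> E (m1 + m2)%MM) ->
  supported_in E1 g1 -> supported_in E2 g2 -> supported_in E (g1 * g2).
Proof.
move=> E12 Eg1 Eg2 m /msuppM_le/allpairsP[[m1 m2] /= [/Eg1 + /Eg2 + ->]].
exact: E12.
Qed.

Variables (n : nat) (e : 'I_n -> 'X_{1..r}).

Definition toric_exponent (c : 'X_{1..n}) : 'X_{1..r} := (\sum_i e i *+ c i)%MM.

Definition toric_monoid (m : 'X_{1..r}) : Prop := exists c, m = toric_exponent c.

Definition toric_images : n.-tuple {mpoly k[r]} := [tuple 'X_[e i] | i < n].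

Lemma toric_exponentD c1 c2 :
  toric_exponent (c1 + c2) = (toric_exponent c1 + toric_exponent c2)%MM.
Proof.
apply/mnmP => j; rewrite mnmDE !mnm_sumE -big_split.
by apply: eq_bigr => i _; rewrite !mulmnE mnmDE mulnDr.
Qed.

Lemma toric_exponent1 i : toric_exponent U_(i) = e i.
Proof.
apply/mnmP => j; rewrite mnm_sumE (bigD1 i) //= mulmnE mnm1E eqxx muln1.
by rewrite big1 ?addn0 // => i' ne; rewrite mulmnE mnm1E eq_sym (negbTE ne) muln0.
Qed.

Lemma toric_exponent0 : toric_exponent 0 = 0%MM.
Proof.
by apply/mnmP => j; rewrite mnm_sumE mnm0E big1 // => i _; rewrite mulmnE mnm0E muln0.
Qed.

Lemma toric_monoidD m1 m2 :
  toric_monoid m1 -> toric_monoid m2 -> toric_monoid (m1 + m2)%MM.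
Proof. by case=> c1 -> [c2 ->]; exists (c1 + c2)%MM; rewrite toric_exponentD. Qed.

Lemma toric_monoid_gen i : toric_monoid (e i).
Proof. by exists U_(i)%MM; rewrite toric_exponent1. Qed.

Lemma toric_imageX c : 'X_[c] \mPo toric_images = 'X_[toric_exponent c].
Proof.
rewrite comp_mpolyX /toric_exponent -mprodXnE; apply: eq_bigr => i _.
by rewrite tnth_mktuple.
Qed.

Lemma toric_image_supported (p : {mpoly k[n]}) :
  supported_in toric_monoid (p \mPo toric_images).
Proof.
rewrite comp_mpolyEX; elim/big_rec: _ => [|c q _]; first exact: supported_in0.
apply: supported_inD; apply: supported_inZ.
by rewrite toric_imageX; apply: supported_inX; exists c.
Qed.

Definition toric_shift (W : pred 'I_n) (m : 'X_{1..r}) : Prop :=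
  exists i s, [/\ W i, toric_monoid s & m = (e i + s)%MM].

Lemma toric_shiftD W m1 m2 :
  toric_monoid m1 -> toric_shift W m2 -> toric_shift W (m1 + m2)%MM.
Proof.
move=> S1 [i [s [Wi Ss ->]]]; exists i, (m1 + s)%MM; split=> //.
  exact: toric_monoidD.
by rewrite !addmA (addmC m1).
Qed.

Variable I : {mpoly k[n]} -> Prop.
Hypothesis I_kernel : forall p, I p <-> p \mPo toric_images = 0.

Definition variables_ideal (W : pred 'I_n) :=
  gen_ideal (fun x : {mpoly k[n]} => I x \/ exists2 i, W i & x = 'X_i).

(** Reduces ideal membership to exponents. From right to left, each monomial of exponent [e i + s]
    lifts to a multiple of ['X_i], and [p] differs from the combined lift by an element of the
    kernel [I]. *)
Lemma variables_idealP W p :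
  variables_ideal W p <-> supported_in (toric_shift W) (p \mPo toric_images).
Proof.
split.
  move: p; apply: gen_ideal_sub => [|q [/I_kernel ->|[i Wi ->]]]; last 2 first.
  - exact: supported_in0.
  - rewrite toric_imageX toric_exponent1; apply: supported_inX.
    exists i, 0%MM; split=> //; last by rewrite addm0.
    by exists 0%MM; rewrite toric_exponent0.
  split=> [|x y Ex Ey|q x Ex]; rewrite ?raddf0 ?raddfD ?rmorphM /=.
  - exact: supported_in0.
  - exact: supported_inD.
  - apply: (supported_inM (E1 := toric_monoid) _ _ Ex) => [m1 m2|]; first exact: toric_shiftD.
    exact: toric_image_supported.
set J := variables_ideal W => Ep.
have idJ : is_ideal J by exact: gen_ideal_is_ideal.
have [J0 JD JM] := idJ.
suff [q Jq eq_pq] : exists2 q, J q & q \mPo toric_images = p \mPo toric_images.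
  rewrite -(subrK q p); apply: JD => //; apply: mem_gen_ideal; left.
  by apply/I_kernel; rewrite raddfB /= eq_pq subrr.
rewrite [p \mPo toric_images]mpolyE.
move: Ep; rewrite /supported_in; elim: (msupp _) => [|m s IHs] Es.
  by exists 0; rewrite ?big_nil ?raddf0.
have [|q Jq eq_q] := IHs; first by move=> m' m's; apply: Es; rewrite inE m's orbT.
have [i [_ [Wi [c ->] mE]]] := Es m (mem_head _ _).
exists ((p \mPo toric_images)@_m *: ('X_[c] * 'X_i) + q).
  apply: (JD) => //; rewrite -mul_mpolyC; do 2!apply: (JM).
  by apply: mem_gen_ideal; right; exists i.
rewrite big_cons raddfD /= eq_q linearZ rmorphM /= !toric_imageX toric_exponent1.
by rewrite -mpolyXD addmC -mE.
Qed.

Lemma irrelevant_toric_monomial c :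
  toric_exponent c != 0%MM -> irrelevant_over I 'X_[c].
Proof.
move=> c0; have [i ci] : exists i, c i != 0%N.
  apply/existsP; apply: contraNT c0 => /existsPn c0.
  suff -> : c = 0%MM by rewrite toric_exponent0.
  by apply/mnmP => i; rewrite mnm0E; apply/eqP; rewrite -[_ == _]negbK.
rewrite -(submK (m := U_(i)%MM) (m' := c)) ?lep1mP // mpolyXD.
have [_ _ JM] := gen_ideal_is_ideal (fun x => I x \/ exists i : 'I_n, x = 'X_i).
by apply: JM; apply: mem_gen_ideal; right; exists i.
Qed.

End MonomialAlgebra.

(** * The monomial curve *)

Section MonomialCurve.
Import GRing.Theory.
Local Open Scope ring_scope.

Definition bimon (x y : nat) : 'X_{1..2} :=
  [multinom if (i : nat) == 0%N then x else y | i < 2].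

Lemma bimon0 x y : bimon x y 0 = x. Proof. by rewrite mnmE. Qed.
Lemma bimon1 x y : bimon x y 1 = y. Proof. by rewrite mnmE. Qed.

Lemma mnm2P (m1 m2 : 'X_{1..2}) : m1 0 = m2 0 -> m1 1 = m2 1 -> m1 = m2.
Proof.
move=> eq0 eq1; apply/mnmP => -[[|[|//]] lt].
- by rewrite (_ : Ordinal lt = 0) //; apply: val_inj.
- by rewrite (_ : Ordinal lt = 1) //; apply: val_inj.
Qed.

Lemma mpolyX_bimon (k : fieldType) x y :
  'X_[bimon x y] = 'X_0 ^+ x * 'X_1 ^+ y :> {mpoly k[2]}.
Proof.
rewrite mpolyXE_id !big_ord_recl big_ord0 mulr1 !mnmE /=.
by congr ('X_ _ ^+ _ * 'X_ _ ^+ _); apply: val_inj.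
Qed.

Lemma mpolyX_neq0 (k : fieldType) n (m : 'X_{1..n}) : 'X_[m] != 0 :> {mpoly k[n]}.
Proof. by rewrite -msize_poly_eq0 msizeX. Qed.

Local Notation degu m := (m 0%R).
Local Notation degv m := (m 1%R).

Variables (k : fieldType) (T : pred nat) (F : nat).
Hypotheses (sgT : numerical_semigroup T) (frobT : is_frobenius T F).
Hypotheses (symT : symmetric_sg T F) (T2 : ~~ T 2%N).

Let d := F.-1.
Let a := small_elts T F.
Let F_ge5 : (4 < F)%N := frobenius_ge5 sgT frobT symT T2.
Let d_gt0 : (0 < d)%N. Proof. by rewrite /d; lia. Qed.
Let Td : T d := semigroup_pred_frobenius sgT frobT symT T2.

Definition curve_weight (i : 'I_(size (small_elts T F)).+1) : nat :=
  nth 0%N (0%N :: small_elts T F) i.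

Definition curve_exponent i : 'X_{1..2} := bimon (curve_weight i) (F.-1 - curve_weight i).
Local Notation e := curve_exponent.

Lemma mem_small_elts x : (x \in small_elts T F) = [&& T x, (0 < x)%N & (x <= F.-1)%N].
Proof. by rewrite mem_filter mem_iota add1n ltnS. Qed.

Lemma last_small_elts : last 0%N (small_elts T F) = F.-1.
Proof.
rewrite /small_elts (_ : F.-1 = F.-2 + 1)%N; last by lia.
by rewrite iotaD filter_cat last_cat /= (_ : 1 + F.-2 = d)%N ?Td //= /d; lia.
Qed.

Lemma curve_weightP i : T (curve_weight i) /\ (curve_weight i <= F.-1)%N.
Proof.
case: i => -[|i] lti; first by rewrite /curve_weight /= semigroup0.
have : nth 0%N a i \in a by apply: mem_nth; rewrite -ltnS.
by rewrite mem_small_elts => /and3P[].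
Qed.

Lemma curve_weight_ex x : T x -> (x <= F.-1)%N -> exists i, curve_weight i = x.
Proof.
move=> Tx xd; have [->|x0] := posnP x; first by exists ord0.
have xa : x \in a by rewrite mem_small_elts Tx x0.
have lti : ((index x a).+1 < (size a).+1)%N by rewrite ltnS index_mem.
by exists (Ordinal lti); rewrite /curve_weight /= nth_index.
Qed.

Lemma monomial_images_toric : monomial_images k a = toric_images k e.
Proof.
apply: eq_from_tnth => i; rewrite !tnth_mktuple last_small_elts mpolyX_bimon /curve_weight.
by case: i => -[|i] lti //=; rewrite expr0 mul1r subn0.
Qed.

(* The homogeneous coordinate ring is spanned by the monomials u^x v^y with
   x in T and d | x + y, i.e. all N-fold sumsets of T \cap [0, d] are as large
   as possible; this is where arithmetic Cohen-Macaulayness comes from. *)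
Lemma curve_monoidP m : toric_monoid e m <-> T (degu m) /\ (F.-1 %| degu m + degv m)%N.
Proof.
split=> [[c ->]|[Tm /dvdnP[N eqm]]].
  pose Q (m : 'X_{1..2}) := T (degu m) /\ (d %| degu m + degv m)%N.
  have Q0 : Q 0%MM by split; rewrite !mnm0E // semigroup0.
  have QD m1 m2 : Q m1 -> Q m2 -> Q (m1 + m2)%MM.
    case=> T1 d1 [T2' d2]; split; rewrite !mnmDE; first exact: semigroupD.
    by rewrite addnACA dvdn_add.
  apply: (big_ind Q) => // i _; elim: (c i) => [|j IHj]; first by rewrite mulm0n.
  rewrite mulmS; apply: QD => //; rewrite /Q bimon0 bimon1.
  by have [? ?] := curve_weightP i; rewrite subnKC.
(* Induction on the level [N]: [semigroup_split_summand] splits off one generator and lowers the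
   level by one. *)
have toric_level x : T x -> (x <= N * d)%N -> toric_monoid e (bimon x (N * d - x)).
  clear eqm Tm; elim: N x => [|N IHN] x Tx xN.
    exists 0%MM; rewrite toric_exponent0; move: xN; rewrite mul0n leqn0 => /eqP ->.
    by apply: mnm2P; rewrite ?bimon0 ?bimon1 mnm0E.
  have [b [Tb bd bx Txb xbN]] := semigroup_split_summand sgT frobT symT T2 Tx xN.
  have [i wi] := curve_weight_ex Tb bd.
  rewrite (_ : bimon _ _ = (e i + bimon (x - b) (N * d - (x - b)))%MM).
    by apply: toric_monoidD; [exact: toric_monoid_gen | exact: IHN].
  move: xN; rewrite mulSn -/d => xN.
  apply: mnm2P; rewrite mnmDE ?bimon0 ?bimon1 wi; first by lia.
  by move: bd bx xbN; rewrite -/d; lia.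
rewrite (_ : m = bimon (degu m) (N * d - degu m)); first by apply: toric_level; rewrite // -eqm leq_addr.
by apply: mnm2P; rewrite ?bimon0 ?bimon1 // -eqm addKn.
Qed.

Definition curve_ideal := @monomial_curve_ideal k (small_elts T F).

Lemma curve_ideal_kernel p : curve_ideal p <-> p \mPo toric_images k e = 0.
Proof. by rewrite /curve_ideal /monomial_curve_ideal monomial_images_toric. Qed.

Lemma curve_ideal_is_ideal : is_ideal curve_ideal.
Proof. exact: kernel_is_ideal curve_ideal_kernel. Qed.

Lemma max_index_subproof : exists i, curve_weight i == F.-1.
Proof. by have [i /eqP] := curve_weight_ex Td (leqnn d); exists i. Qed.

Definition max_index := xchoose max_index_subproof.

Lemma curve_exponent_first : e ord0 = bimon 0 F.-1.
Proof. by rewrite /curve_exponent /curve_weight /= subn0. Qed.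

Lemma curve_exponent_last : e max_index = bimon F.-1 0.
Proof.
by rewrite /curve_exponent (eqP (xchooseP max_index_subproof)) subnn.
Qed.

(** Removing d from the exponent of v keeps both conditions of [curve_monoidP], so divisibility by
    v^d inside the monoid depends on that exponent alone. *)
Lemma shift_firstP m : toric_shift e (pred1 ord0) m <->
  [/\ T (degu m), (F.-1 %| degu m + degv m)%N & (F.-1 <= degv m)%N].
Proof.
split=> [[i [s [/eqP -> /curve_monoidP[Ts ds] ->]]]|[Tm dm md]].
  rewrite curve_exponent_first !mnmDE !(bimon0, bimon1) add0n leq_addr.
  by split=> //; rewrite addnCA dvdn_addr.
exists ord0, (bimon (degu m) (degv m - d)); split=> //=.
  apply/curve_monoidP; rewrite bimon0 bimon1; split=> //.
  by rewrite addnBA // dvdn_subl ?dvdnn // (leq_trans md) ?leq_addl.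
by rewrite curve_exponent_first; apply: mnm2P; rewrite mnmDE !(bimon0, bimon1) ?subnKC.
Qed.

(** The monoid elements violating this condition form the Apery set. The guard [F.-1 <= degu m]
    matters: truncated subtraction would otherwise give 0, which lies in [T]. *)
Lemma shift_endsP m : toric_shift e (pred2 ord0 max_index) m <->
  [/\ T (degu m), (F.-1 %| degu m + degv m)%N
    & (F.-1 <= degv m)%N || (F.-1 <= degu m)%N && T (degu m - F.-1)%N].
Proof.
split=> [[i [s [/orP[]/eqP -> Ss ->]]]|[Tm dm /orP[md|/andP[md Tmd]]]].
- have : toric_shift e (pred1 ord0) (e ord0 + s)%MM by exists ord0, s.
  by case/shift_firstP=> ? ? ->.
- case/curve_monoidP: Ss => Ts ds.
  rewrite curve_exponent_last !mnmDE !(bimon0, bimon1) add0n leq_addr addKn Ts orbT.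
  by split=> //; rewrite ?(semigroupD sgT) // -addnA dvdn_addr.
- have [i [s [/eqP -> Ss ->]]] := (shift_firstP m).2 (And3 Tm dm md).
  by exists ord0, s; split; rewrite //= eqxx.
exists max_index, (bimon (degu m - d) (degv m)); split; rewrite ?inE ?eqxx ?orbT //.
  apply/curve_monoidP; rewrite bimon0 bimon1; split=> //.
  by rewrite addnC addnBA // dvdn_subl ?(leq_trans md) ?leq_addl // addnC.
by rewrite curve_exponent_last; apply: mnm2P; rewrite mnmDE !(bimon0, bimon1) ?subnKC.
Qed.

Definition curve_params : seq {mpoly k[(size (small_elts T F)).+1]} :=
  [:: 'X_ord0; 'X_max_index].

Lemma variables_ideal1P (i : 'I_(size (small_elts T F)).+1) p :
  ideal_plus curve_ideal [:: 'X_i] p <->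
  supported_in (toric_shift e (pred1 i)) (p \mPo toric_images k e).
Proof.
rewrite -(variables_idealP curve_ideal_kernel); apply: eq_gen_ideal => q; split=> -[]; [by left| |by left|].
- by rewrite inE => /eqP ->; right; exists i => /=.
- by case=> j /eqP -> ->; right; rewrite inE.
Qed.

Lemma curve_params_idealP p :
  ideal_plus curve_ideal curve_params p <->
  supported_in (toric_shift e (pred2 ord0 max_index)) (p \mPo toric_images k e).
Proof.
rewrite -(variables_idealP curve_ideal_kernel); apply: eq_gen_ideal => q; split=> -[]; [by left| |by left|].
- by rewrite !inE => /orP[]/eqP ->; right; eexists => //=; rewrite eqxx ?orbT.
- by case=> j /orP[]/eqP -> ->; right; rewrite !inE eqxx ?orbT.
Qed.

Lemma irrelevant_curveP y : irrelevant_over curve_ideal y ->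
  supported_in (toric_shift e predT) (y \mPo toric_images k e).
Proof.
rewrite -(variables_idealP curve_ideal_kernel); apply: gen_idealS => q [|[i ->]]; [by left|].
by right; exists i.
Qed.

Lemma toric_imageU i : 'X_i \mPo toric_images k e = 'X_[e i].
Proof. by rewrite toric_imageX toric_exponent1. Qed.

(** The first parameter is regular because k[u, v] is a domain. For the second, multiplying by u^d
    leaves the exponent of v unchanged, and by [shift_firstP] only that exponent decides. Properness
    holds as the exponents of 1 are below d. *)
Lemma curve_params_regular : regular_seq_in_max curve_ideal curve_params.
Proof.
split=> [x||].
- by rewrite !inE => /orP[]/eqP ->; apply: mem_gen_ideal; right; eexists.
- case=> [|[|//]] _ g /=.
    rewrite !(ideal_plus_nil _ curve_ideal_is_ideal) !curve_ideal_kernel.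
    rewrite rmorphM /= toric_imageU => /eqP.
    by rewrite mulf_eq0 (negbTE (mpolyX_neq0 _ _)) orbF => /eqP.
  rewrite !variables_ideal1P rmorphM /= toric_imageU => Eg m mg.
  have /Eg/shift_firstP[_ _] : (e max_index + m)%MM \in
      msupp ((g \mPo toric_images k e) * 'X_[e max_index]).
    by rewrite mcoeff_msupp mcoeffMX -mcoeff_msupp.
  rewrite curve_exponent_last mnmDE bimon1 add0n => md.
  by have /curve_monoidP[] := toric_image_supported mg; move=> *; apply/shift_firstP.
- move=> /curve_params_idealP; rewrite rmorph1 => /(_ 0%MM).
  rewrite msupp1 inE eqxx => /(_ isT)/shift_endsP[_ _].
  by rewrite !mnm0E !leqn0 (gtn_eqF d_gt0).
Qed.

Lemma curve_depth : depth_quot curve_ideal 2.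
Proof.
split; last exact: no_regular_seq3_over_bivariate_kernel curve_ideal_kernel.
by exists curve_params; split=> //; exact: curve_params_regular.
Qed.

Lemma curve_krull_dim : krull_dim_quot curve_ideal 2.
Proof.
split; last exact: no_prime_chain3_over_bivariate_kernel curve_ideal_kernel.
(* The chain consists of the kernels of the parametrisation and of its specialisations at u = 0 and
   at u = v = 0. Writing these as composites makes the inclusions immediate; x_n and x_0 witness
   strictness. *)
pose q1 : 2.-tuple {mpoly k[2]} := [tuple 0; 'X_1].
pose q2 : 2.-tuple {mpoly k[2]} := [tuple 0; 0].
pose f0 := comp_mpoly (toric_images k e).
pose J i := match i with
  | 0%N => fun p => f0 p = 0
  | 1%N => fun p => (comp_mpoly q1 \o f0) p = 0
  | _ => fun p => (comp_mpoly q2 \o (comp_mpoly q1 \o f0)) p = 0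
  end.
have q1X x y : 'X_[bimon x y] \mPo q1 = 0 ^+ x * 'X_1 ^+ y.
  by rewrite comp_mpolyX !big_ord_recl big_ord0 mulr1 !mnmE !(tnth_nth 0) /=.
have q2X x y : 'X_[bimon x y] \mPo q2 = 0 ^+ x * 0 ^+ y.
  by rewrite comp_mpolyX !big_ord_recl big_ord0 mulr1 !mnmE !(tnth_nth 0) /=.
have zero_d : 0 ^+ d = 0 :> {mpoly k[2]} by rewrite expr0n (gtn_eqF d_gt0).
have v_d : ('X_1 ^+ d : {mpoly k[2]}) = 'X_[bimon 0 d] by rewrite mpolyX_bimon expr0 mul1r.
exists J; split=> i.
- move=> _; split; last first.
    move=> p /curve_ideal_kernel; rewrite -/(f0 p) => f0p.
    by case: i => [|[|i]] //=; rewrite f0p !raddf0.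
  case: i => [|[|i]]; exact: rmorphism_kernel_prime.
- case: i => [|[|//]] _ /=.
  + split=> [p /= ->|]; first by rewrite raddf0.
    exists 'X_max_index; rewrite /f0 toric_imageU curve_exponent_last q1X zero_d mul0r.
    by split=> //; apply/eqP; exact: mpolyX_neq0.
  + split=> [p /= ->|]; first by rewrite raddf0.
    exists 'X_ord0; rewrite /f0 toric_imageU curve_exponent_first q1X expr0 mul1r.
    split; last by rewrite v_d; apply/eqP; exact: mpolyX_neq0.
    by rewrite v_d q2X zero_d mulr0.
Qed.

(* The Apery set of S with respect to the two parameters has the maximum
   w = (2d + 1, d - 1), and symmetry of T says exactly that m |-> w - m maps
   the set to itself; multiplication by the monomial w - m thus detects the
   coefficient at m, which forces the socle to be spanned by w. *)
Lemma curve_socle : socle_dim_one curve_ideal curve_params.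
Proof.
pose w := bimon (2 * d + 1) (d - 1).
have wS : toric_monoid e w.
  apply/curve_monoidP; rewrite bimon0 bimon1; split.
    by apply: (gt_frobenius frobT); rewrite /d; lia.
  by rewrite (_ : 2 * d + 1 + (d - 1) = 3 * d)%N ?dvdn_mull //; lia.
have w_shift : ~ toric_shift e (pred2 ord0 max_index) w.
  case/shift_endsP; rewrite bimon0 bimon1 => _ _ /orP[|/andP[_]]; first by lia.
  rewrite (_ : 2 * d + 1 - d = F)%N; last by rewrite /d; lia.
  by apply/negP; exact: notin_frobenius.
case: (wS) => c wc; exists 'X_[c]; split=> [y /irrelevant_curveP Ey||y socy].
- apply/curve_params_idealP; rewrite rmorphM /= toric_imageX -wc.
  apply: (supported_inM (E1 := toric_shift e predT) (E2 := eq w)) Ey _; last first.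
    by move=> m; rewrite msuppX inE => /eqP.
  move=> _ _ [i [s [_ /curve_monoidP[Ts ds] ->]]] <-.
  have mS : toric_monoid e (e i + s)%MM.
    by apply: toric_monoidD; [exact: toric_monoid_gen | exact/curve_monoidP].
  have m_gt0 : (0 < degu (e i + s)%MM + degv (e i + s)%MM)%N.
    rewrite !mnmDE bimon0 bimon1 addnACA subnKC; last by have [] := curve_weightP i.
    by rewrite addn_gt0 d_gt0.
  move: (e i + s)%MM mS m_gt0 => m mS m_gt0.
  have [Tm dm] := (curve_monoidP _).1 mS.
  have [Tmw dmw] := (curve_monoidP _).1 (toric_monoidD mS wS).
  apply/shift_endsP; split=> //.
  rewrite !mnmDE !(bimon0, bimon1).
  (* If [m] involves v, the product has v-exponent at least d. Otherwise [m] is a positive power of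
     u^d, and removing d still leaves a u-exponent above [F]. *)
  have [m1|m1] := posnP (degv m); last by apply/orP; left; rewrite -/d; lia.
  apply/orP; right; rewrite m1 addn0 in dm m_gt0.
  have dle := dvdn_leq m_gt0 dm.
  apply/andP; split; first by rewrite -/d; lia.
  by apply: (gt_frobenius frobT); move: dle; rewrite /d; lia.
- move=> /curve_params_idealP /(_ w); rewrite toric_imageX -wc msuppX mem_head.
  by move=> /(_ isT).
- exists ((y \mPo toric_images k e)@_w); apply/curve_params_idealP => m.
  rewrite mcoeff_msupp raddfB /= linearZ /= toric_imageX -wc mcoeffB mcoeffZ mcoeffX.
  case: (eqVneq w m) => [<-|wm]; first by rewrite mulr1 subrr eqxx.
  rewrite mulr0 subr0 => ym.
  have /curve_monoidP[Tm dm] : toric_monoid e m.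
    by apply: (@toric_image_supported _ _ _ e y); rewrite mcoeff_msupp.
  apply/shift_endsP; split=> //; apply: contraPT w_shift => nshift.
  pose m' := bimon (2 * d + 1 - degu m) (d - 1 - degv m).
  move: nshift; rewrite negb_or negb_and -ltnNge -/d -!ltnNge => /andP[m1d m0d].
  (* If [degu m] is below d, the difference exceeds [F]. Otherwise [degu m - d] is a gap, and its
     mirror image F - (degu m - d) is 2d + 1 - degu m. *)
  have /andP[m0w Tm'] : (degu m <= 2 * d + 1)%N && T (2 * d + 1 - degu m)%N.
    have [m0|m0] := ltnP (degu m) d.
      apply/andP; split; first by lia.
      by apply: (gt_frobenius frobT); move: m0; rewrite /d; lia.
    rewrite ltnNge m0 /= in m0d.
    have m0F : (degu m - d <= F)%N.
      by rewrite leqNgt; apply: contra m0d; exact: (gt_frobenius frobT).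
    have := m0d; rewrite -(symmetricP sgT frobT symT m0F).
    rewrite (_ : F - (degu m - d) = 2 * d + 1 - degu m)%N; last by rewrite /d in m0 *; lia.
    by move=> ->; rewrite andbT /d in m0 m0F *; lia.
  have mm'w : (m + m')%MM = w.
    by apply: mnm2P; rewrite mnmDE !(bimon0, bimon1); lia.
  have /curve_monoidP[_ dw] := wS.
  have [c' m'c'] : toric_monoid e m'.
    apply/curve_monoidP; rewrite /m' bimon0 bimon1; split=> //.
    rewrite -(dvdn_addr _ dm); move: dw; rewrite -mm'w !mnmDE !(bimon0, bimon1).
    by rewrite addnACA.
  have /socy/curve_params_idealP Ey : irrelevant_over curve_ideal 'X_[c'].
    apply: irrelevant_toric_monomial (e) _ _ _; rewrite -m'c'.
    by apply: contra_neq wm => m'0; rewrite -mm'w m'0 addm0.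
  (* Multiplication by a monomial only shifts exponents, so the nonzero coefficient at [m] moves to
     [w] without cancellation, against [w_shift]. *)
  apply; apply: Ey; rewrite rmorphM /= toric_imageX -m'c' mulrC -mm'w addmC.
  by rewrite mcoeff_msupp mcoeffMX.
Qed.

Lemma curve_gorenstein : arith_gorenstein_curve k (small_elts T F).
Proof.
split; first by exists 2%N; split; [exact: curve_krull_dim | exact: curve_depth].
exists 2%N, curve_params; split=> //; first exact: curve_depth.
  exact: curve_params_regular.
exact: curve_socle.
Qed.

End MonomialCurve.

Theorem mainTheorem12 (k : fieldType) (T : pred nat) (F : nat) :
  infinite_field k ->
  numerical_semigroup T ->
  is_frobenius T F ->
  symmetric_sg T F ->
  ~~ T 2 ->
  arith_gorenstein_curve k (small_elts T F).
Proof. by move=> _; exact: curve_gorenstein. Qed.
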